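(* Let $g\ge1$ be an integer and put $h=\max\{g,12\}$. There is a constant $C_h$, depending only on $h$, such that, for every integer $p\ge3$, $$m_g(p)\le C_h\,p^{3h-1},\qquad d_g(p)\le 96p(p-1)<96p^2.$$ (The two estimates are not asserted to hold for a single graph.)
   Context: All graphs and digraphs are finite. An oriented graph is a loopless digraph with no pair of opposite arcs (and no parallel arcs); it is acyclic if it has no directed cycle. $U(H)$ denotes the underlying simple undirected graph of $H$; $H$ is connected if $U(H)$ is connected. The girth of a graph is the length of a shortest cycle ($\infty$ for a forest). A tournament is an orientation of a complete graph. A homomorphism is a vertex map preserving every arc. $\vec{T}_k$ is the transitive tournament on $[k]$, with arcs $ij$ for $i<j$. $\Delta^+(H),\Delta^-(H)$ are the maximum outdegree and maximum indegree of $H$. For a nonempty acyclic oriented graph $H$, $p(H)$ is the maximum number of vertices on a directed path in $H$. The compressibility $\tau(H)$ is the least positive integer $n$ such that $H$ admits a homomorphism to every tournament of order $n$. $r_{\mathrm{tr}}(p)$ is the least $n$ such that every tournament of order $n$ contains $\vec{T}_p$. Two vertices are linked if they are the endpoints of a directed path of length at most two, in either direction. $\omega_{\mathrm{ro}}(H)$ is the maximum order of a set of vertices pairwise linked in $H$. An oriented clique is an oriented graph in which every two vertices are linked within that graph; $\omega_{\mathrm{ao}}(H)$ is the maximum order of an oriented clique that is a subgraph of $H$. For integers $p\ge3$, $g\ge1$, let $\mathcal H_g(p)$ be the family of connected acyclic oriented graphs $H$ such that $\operatorname{girth}(U(H))>g$, $\omega_{\mathrm{ao}}(H)=\omega_{\mathrm{ro}}(H)=3$,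 $p(H)=p$ and $\tau(H)=r_{\mathrm{tr}}(p)$. This family is nonempty for all such $p,g$. Define $$m_g(p)=\min_{H\in\mathcal H_g(p)}|V(H)|,\qquad d_g(p)=\min_{H\in\mathcal H_g(p)}\max\{\Delta^+(H),\Delta^-(H)\}.$$ *)

(* Defs.v *)
From mathcomp Require Import all_boot.

Set Implicit Arguments.
Unset Strict Implicit.
Unset Printing Implicit Defensive.

Definition is_least (P : nat -> Prop) (n : nat) : Prop :=
  P n /\ forall k, P k -> n <= k.

(* Digraphs are arc relations on a finite vertex type. *)
Definition oriented (T : finType) (e : rel T) : Prop :=
  irreflexive e /\ forall x y, e x y -> ~~ e y x.

Definition acyclic (T : finType) (e : rel T) : Prop :=
  forall c : seq T, c != [::] -> ~~ ucycleb e c.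

Definition underlying (T : finType) (e : rel T) : rel T :=
  fun x y => e x y || e y x.

Definition connected (T : finType) (e : rel T) : Prop :=
  forall x y, connect (underlying e) x y.

Definition max_outdeg (T : finType) (e : rel T) : nat :=
  \max_(x : T) #|[set y | e x y]|.

Definition max_indeg (T : finType) (e : rel T) : nat :=
  \max_(x : T) #|[set y | e y x]|.

Definition has_cycle (T : finType) (a : rel T) (k : nat) : bool :=
  (2 < k) && [exists c : k.-tuple T, ucycleb a c].

(* [None] stands for an infinite girth; a cycle has at most [#|T|] vertices. *)
Definition girth (T : finType) (a : rel T) : option nat :=
  ohead [seq k <- iota 0 #|T|.+1 | has_cycle a k].

Definition girth_gt (T : finType) (a : rel T) (g : nat) : bool :=
  if girth a is Some k then g < k else true.

(* Order means number of vertices. *)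
Definition path_order (T : finType) (e : rel T) : nat :=
  \max_(k < #|T|.+1 | [exists s : k.-tuple T, uniq s && sorted e s]) k.

Definition tournament (V : finType) (t : rel V) : Prop :=
  irreflexive t /\ forall x y, x != y -> t x y (+) t y x.

Definition homomorphism (T V : finType) (e : rel T) (t : rel V) (f : T -> V)
    : Prop :=
  forall x y, e x y -> t (f x) (f y).

Definition is_compressibility (T : finType) (e : rel T) : nat -> Prop :=
  is_least (fun n => 0 < n /\
    forall (V : finType) (t : rel V), #|V| = n -> tournament t ->
      exists f : T -> V, homomorphism e t f).

Definition trans_tournament (p : nat) : rel 'I_p := fun i j => i < j.

Definition is_trans_ramsey (p : nat) : nat -> Prop :=
  is_least (fun n =>
    forall (V : finType) (t : rel V), #|V| = n -> tournament t ->
      exists f : 'I_p -> V,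
        injective f /\ homomorphism (@trans_tournament p) t f).

(* Only meant for distinct [x] and [y]. *)
Definition linked (T : finType) (e : rel T) (x y : T) : bool :=
  [|| e x y, e y x, [exists z, e x z && e z y] | [exists z, e y z && e z x]].

Definition pairwise_linked (T : finType) (e : rel T) (A : {set T}) : bool :=
  [forall x in A, forall y in A, (x != y) ==> linked e x y].

Definition omega_ro (T : finType) (e : rel T) : nat :=
  \max_(A : {set T} | pairwise_linked e A) #|A|.

(* A subgraph is a pair of a vertex set and an arc set on it. *)
Definition subgraph (T : finType) (e : rel T)
    (K : {set T} * {set T * T}) : bool :=
  [forall a in K.2, [&& e a.1 a.2, a.1 \in K.1 & a.2 \in K.1]].

(* Subgraphs of an oriented graph are oriented, so only linkedness is tested;
   intermediate vertices lie in [K.1] because all arcs of [K.2] do. *)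
Definition oriented_clique (T : finType) (K : {set T} * {set T * T}) : bool :=
  pairwise_linked (fun x y => (x, y) \in K.2) K.1.

Definition omega_ao (T : finType) (e : rel T) : nat :=
  \max_(K : {set T} * {set T * T} | subgraph e K && oriented_clique K) #|K.1|.

Record calH (g p : nat) (T : finType) (e : rel T) : Prop := CalH {
  calH_oriented : oriented e;
  calH_acyclic : acyclic e;
  calH_connected : connected e;
  calH_girth : girth_gt (underlying e) g;
  calH_omega_ao : omega_ao e = 3;
  calH_omega_ro : omega_ro e = 3;
  calH_path_order : path_order e = p;
  calH_compressibility :
    exists n, is_compressibility e n /\ is_trans_ramsey p n
}.

Definition is_m (g p : nat) : nat -> Prop :=
  is_least (fun n =>
    exists (T : finType) (e : rel T), calH g p e /\ #|T| = n).

Definition is_d (g p : nat) : nat -> Prop :=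
  is_least (fun n =>
    exists (T : finType) (e : rel T),
      calH g p e /\ maxn (max_outdeg e) (max_indeg e) = n).

(* Main.v *)
From mathcomp Require Import all_boot all_order all_algebra zify ring.
From mathcomp Require Import reals Rstruct sequences exp.
From Stdlib Require Import Classical.
Require Import Defs.

(* Let D be a tournament on r_tr(p) - 1 vertices without a transitive
   subtournament of order p.  On p classes of 2L vertices, arcs are added one
   at a time from lower to higher classes, a fixed number of rounds for every
   pair of classes, never joining two close vertices and never exceeding the
   degree bound.  The aim is to violate every partial D-colouring G that uses
   exactly L vertices of each class, all unsaturated.  Two coloured vertices
   sampled from each class give 2p vertices of D, hence at least p + 1 pairs
   that are not arcs in the right direction; averaging, 4 W >= L^2 + L K, where
   W counts the pairs of coloured vertices that an arc would violate and K the
   vertices outside the majority colours of their classes.  As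
   |D| < 2^p, only exp(O(p(L + K))) colourings have a given K, so O(p) arcs per
   vertex and pair of classes suffice, by the method of conditional
   expectations.  As at most L vertices of each class become saturated, the
   final graph has no homomorphism to D.  One of its components has none
   either, and this component serves for both estimates. *)

Set Implicit Arguments.
Unset Strict Implicit.
Unset Printing Implicit Defensive.

(** * Transitive subtournaments *)

Lemma tournament_neq (V : finType) (t : rel V) x y :
  tournament t -> t x y -> x != y.
Proof. by case=> irr _ txy; apply: contraL txy => /eqP->; rewrite irr. Qed.

Lemma pairwise_trans_tournament (V : finType) (t : rel V) (s : seq V) :
  tournament t -> pairwise t s ->
  exists f : 'I_(size s) -> V,
    injective f /\ homomorphism (@trans_tournament (size s)) t f.
Proof.
move=> tt ts; pose f := tnth (in_tuple s).
have hf : homomorphism (@trans_tournament (size s)) t f.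
  move=> i j ij; have x0 := f i; rewrite /f !(tnth_nth x0) /=.
  by move/(pairwiseP x0): ts; apply=> //; rewrite inE ltn_ord.
exists f; split=> // i j fij; apply/val_inj/eqP.
by case: (ltngtP (val i) (val j)) => // /hf /(tournament_neq tt);
  rewrite fij eqxx.
Qed.

Lemma trans_tournament_pairwise (V : finType) (t : rel V) k (f : 'I_k -> V) :
  homomorphism (@trans_tournament k) t f ->
  exists2 s, size s = k & pairwise t s.
Proof.
move=> hf; exists (codom f); first by rewrite size_codom card_ord.
rewrite /codom /image_mem pairwise_map.
have: pairwise (fun i j : 'I_k => i < j) (enum 'I_k).
  by rewrite -(pairwise_map val ltn) val_enum_ord -sorted_pairwise ?iota_ltn_sorted //;
    exact: ltn_trans.
by apply: sub_pairwise => i j; apply: hf.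
Qed.

(** One of the two neighbourhoods of [x] in [A] keeps at least [2 ^ k] vertices, and [x] goes in
    front of or behind the sequence found there. *)
Lemma trans_ramsey_pow2 (V : finType) (t : rel V) k (A : {set V}) :
  tournament t -> 2 ^ k <= #|A| ->
  exists s, [/\ size s = k.+1, {subset s <= A} & pairwise t s].
Proof.
move=> tt; elim: k A => [|k IH] A leA.
  have /card_gt0P[x xA] : 0 < #|A| by [].
  by exists [:: x]; split=> // y; rewrite inE => /eqP->.
have /card_gt0P[x xA] : 0 < #|A| by apply: leq_trans leA; rewrite expn_gt0.
pose O := [set y in A | t x y]; pose I := [set y in A | t y x].
have : 2 ^ k <= #|O| \/ 2 ^ k <= #|I|.
  have sA : A :\ x \subset O :|: I.
    apply/subsetP=> y; rewrite !inE => /andP[yx ->] /=.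
    by move: (tt.2 y x yx); case: (t x y); case: (t y x).
  have := leq_trans (subset_leq_card sA) (leq_card_setU O I).
  by have := cardsD1 x A; rewrite xA; move: leA; rewrite expnS; lia.
case=> /IH[s [ss sA ts]].
  exists (x :: s); split; rewrite /= ?ss //.
    by move=> y; rewrite inE => /orP[/eqP->//|/sA]; rewrite inE => /andP[].
  by rewrite ts andbT; apply/allP=> y /sA; rewrite inE => /andP[].
exists (rcons s x); split; rewrite ?size_rcons ?ss //.
  by move=> y; rewrite mem_rcons inE => /orP[/eqP->//|/sA]; rewrite inE => /andP[].
by rewrite pairwise_rcons ts andbT; apply/allP=> y /sA; rewrite inE => /andP[].
Qed.

(** * Bad pairs in a doubled sample *)

Fixpoint badpairs (V : Type) (r : rel V) (s : seq V) : nat :=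
  if s is x :: s' then count (fun y => ~~ r x y) s' + badpairs r s' else 0.

(* Deleting one element of each bad pair leaves no bad pair. *)
Lemma badpairs_subseq (V : eqType) (r : rel V) (s : seq V) :
  exists s', [/\ subseq s' s, pairwise r s' & size s <= size s' + badpairs r s].
Proof.
elim: s => [|x s [s' [sub pw le]]]; first by exists [::].
case: (posnP (count (fun y => ~~ r x y) s)) => [c0 | c1].
  exists (x :: s'); split; rewrite /= ?eqxx ?c0 ?add0n ?addSn ?ltnS //.
  rewrite pw andbT; apply/allP => y /(mem_subseq sub) ys.
  move/eqP: c0; rewrite -leqn0 leqNgt -has_count => /hasPn/(_ y ys).
  by rewrite negbK.
exists s'; split=> //=; first by apply: subseq_trans sub (subseq_cons _ _).
by rewrite addnCA -add1n; apply: leq_add.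
Qed.

Section Doubling.

Variables (V : finType) (t : rel V) (p : nat).
Hypothesis tt : tournament t.
Hypothesis no_trans : forall s, size s = p -> ~~ pairwise t s.

(** A subsequence without bad pairs is transitive, hence shorter than [p]. For [2p] entries this
    yields at least [p + 1] bad pairs; by irreflexivity a repeated vertex counts as one. *)
Lemma ltn_badpairs (s : seq V) : size s < p + badpairs t s.
Proof.
have [s' [_ pw /leq_ltn_trans->//]] := badpairs_subseq t s.
rewrite ltn_add2r ltnNge; apply/negP=> le.
have /negP[] := no_trans (size_takel le).
exact: subseq_pairwise (take_subseq _ _) pw.
Qed.

Definition nontrans (c : 'I_p * bool -> V) (i j : 'I_p) : nat :=
  \sum_(b : bool * bool) ~~ t (c (i, b.1)) (c (j, b.2)).

(* Put the two vertices of each index [i] in the order of the arc between them: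
   then they form a bad pair only when they coincide. *)
Lemma badpairs_double (c : 'I_p * bool -> V) :
  p < \sum_i (c (i, true) == c (i, false))
      + \sum_(i : 'I_p) \sum_(j : 'I_p | i < j) nontrans c i j.
Proof.
pose b i := ~~ t (c (i, true)) (c (i, false)).
pose pr i := [:: c (i, ~~ b i); c (i, b i)].
pose Y l := flatten [seq pr i | i <- l].
have szY l : size (Y l) = (size l).*2.
  by elim: l => //= i l IH; rewrite IH doubleS.
have cntY i b' l : count (fun y => ~~ t (c (i, b')) y) (Y l) =
    \sum_(j <- l) \sum_(b'' : bool) ~~ t (c (i, b')) (c (j, b'')).
  elim: l => [|j l IH]; first by rewrite big_nil.
  rewrite big_cons /= -IH addnA; congr (_ + _).
  by rewrite big_bool /=; case: (b j) => //=; rewrite addnC.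
(* The pair inside a block contributes only the coincidence of its two vertices; two different
   blocks contribute all four cross pairs, however each block is ordered. *)
have badY l : pairwise (fun i j : 'I_p => i < j) l -> badpairs t (Y l) =
    \sum_(i <- l) (c (i, true) == c (i, false)) +
    \sum_(i <- l) \sum_(j <- l | i < j) nontrans c i j.
  elim: l => [|i l IH] /=; first by rewrite !big_nil.
  case/andP=> il pl; rewrite !cntY IH // !big_cons ltnn /= /b.
  have -> : ~~ t (c (i, ~~ ~~ t (c (i, true)) (c (i, false))))
      (c (i, ~~ t (c (i, true)) (c (i, false)))) = (c (i, true) == c (i, false)).
    case: (eqVneq (c (i, true)) (c (i, false))) => [e|ne].
      by case: (t (c (i, true)) (c (i, false))); rewrite /= ?e tt.1.
    move: (tt.2 _ _ ne); case E: (t (c (i, true)) (c (i, false))) => /=.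
      by rewrite E.
    by move=> ->.
  rewrite -!addnA; congr (_ + _).
  have -> : \sum_(j <- l | i < j) nontrans c i j = \sum_(j <- l) nontrans c i j.
    rewrite big_seq_cond [RHS]big_seq; apply: eq_bigl => j.
    by case jl: (j \in l) => //=; rewrite (allP il).
  have -> : \sum_(j <- l) \sum_(j0 <- i :: l | j < j0) nontrans c j j0 =
     \sum_(j <- l) \sum_(j0 <- l | j < j0) nontrans c j j0.
    apply: eq_big_seq => j jl; rewrite big_cons ltnNge ltnW //; exact: (allP il).
  suff -> : \sum_(j <- l) nontrans c i j =
      \sum_(j <- l) \sum_(b'' : bool) ~~ t (c (i, ~~ b i)) (c (j, b'')) +
      \sum_(j <- l) \sum_(b'' : bool) ~~ t (c (i, b i)) (c (j, b'')).
    by rewrite addnA [RHS]addnCA.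
  rewrite -big_split /=; apply: eq_bigr => j _.
  rewrite /nontrans -(pair_big predT predT (fun b1 b2 => (~~ t (c (i, b1)) (c (j, b2)) : nat))) /=.
  by rewrite [LHS]big_bool /=; case: (b i) => //=; rewrite addnC.
have := ltn_badpairs (Y (enum 'I_p)).
rewrite szY size_enum_ord -addnn ltn_add2l badY.
  by rewrite !big_enum /=; under [X in _ + X]eq_bigr => i _ do rewrite big_enum_cond.
by rewrite -(pairwise_map val ltn) val_enum_ord -sorted_pairwise ?iota_ltn_sorted //;
    exact: ltn_trans.
Qed.

End Doubling.

(** If [w i] is drawn uniformly and independently from each [S i], then [(w a, w b)] is uniform on
    [S a] times [S b]. The factor [L ^ 2] clears the denominator. *)
Lemma family_two_point (I X : finType) (S : I -> {set X}) (L : nat) (a b : I)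
    (F : X -> X -> nat) :
  a != b -> (forall i, #|S i| = L) ->
  (\sum_(w : {ffun I -> X} | w \in family S) F (w a) (w b)) * L ^ 2 =
  L ^ #|I| * \sum_(x in S a) \sum_(y in S b) F x y.
Proof.
move=> ab SL.
rewrite (partition_big (fun w : {ffun I -> X} => w a) (mem (S a))) /=; last first.
  by move=> w /familyP.
rewrite big_distrl big_distrr /=; apply: eq_bigr => x xS.
rewrite (partition_big (fun w : {ffun I -> X} => w b) (mem (S b))) /=; last first.
  by move=> w /andP[/familyP].
rewrite big_distrl big_distrr /=; apply: eq_bigr => y yS.
(* Fixing both values leaves a product family with singletons at [a] and [b], of cardinality [L] to
   the power [#|I| - 2]. *)
pose S' i := if i == a then [set x] else if i == b then [set y] else S i.
rewrite (eq_bigl (mem (family S'))); last first.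
  move=> w /=; apply/idP/idP.
    case/andP=> /andP[/familyP wS /eqP wa] /eqP wb; apply/familyP=> i.
    rewrite /S'; case: eqP => [->|_]; first by rewrite inE wa.
    by case: eqP => [->|_]; rewrite ?inE ?wb.
  move=> /familyP wS.
  have wa : w a = x by have := wS a; rewrite /S' eqxx inE => /eqP.
  have wb : w b = y.
    by have := wS b; rewrite /S' eq_sym (negPf ab) eqxx inE => /eqP.
  rewrite wa wb !eqxx !andbT; apply/familyP=> i.
  have := wS i; rewrite /S'; case: eqP => [->|_]; first by rewrite wa.
  by case: eqP => [->|_]; rewrite ?wb.
rewrite (eq_bigr (fun _ => F x y)); last first.
  move=> w /familyP wS.
  have wa : w a = x by have := wS a; rewrite /S' eqxx inE => /eqP.
  have wb : w b = y.
    by have := wS b; rewrite /S' eq_sym (negPf ab) eqxx inE => /eqP.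
  by rewrite wa wb.
rewrite sum_nat_const mulnAC; congr (_ * _).
rewrite card_family foldrE big_image /=.
rewrite (bigD1 a) //= (bigD1 b) 1?eq_sym //= /S' eqxx cards1 mul1n.
rewrite [b == a]eq_sym (negPf ab) eqxx.
rewrite cards1 mul1n.
rewrite (eq_bigr (fun _ => L)); last by move=> i /andP[/negPf-> /negPf->]; apply: SL.
rewrite prod_nat_const -expnD; congr (_ ^ _).
by rewrite addnC -[RHS](cardC (pred2 a b)) card2 ab; congr (_ + _); apply: eq_card => i;
  rewrite !inE negb_or.
Qed.

Section DoublingAverage.

Variables (V X : finType) (t : rel V) (p L : nat).
Variables (S : 'I_p -> {set X}) (col : 'I_p -> X -> V).
Hypothesis tt : tournament t.
Hypothesis no_trans : forall s, size s = p -> ~~ pairwise t s.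
Hypothesis L_gt0 : 0 < L.
Hypothesis SL : forall i, #|S i| = L.

Let W i j := \sum_(x in S i) \sum_(y in S j) ~~ t (col i x) (col j y).

(** [badpairs_double] is averaged over two independent draws from each [S i]. The factor 4 comes
    from the four choices of copies in [nontrans]. *)
Lemma doubling_average :
  p.+1 * L ^ 2 <=
    \sum_i \sum_(x in S i) \sum_(y in S i) (col i x == col i y)
    + 4 * \sum_(i : 'I_p) \sum_(j : 'I_p | i < j) W i j.
Proof.
pose S2 (q : 'I_p * bool) := S q.1.
have S2L q : #|S2 q| = L by apply: SL.
pose c (w : {ffun 'I_p * bool -> X}) (q : 'I_p * bool) := col q.1 (w q).
pose B w := \sum_i (c w (i, true) == c w (i, false))
      + \sum_(i : 'I_p) \sum_(j : 'I_p | i < j) nontrans t (c w) i j.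
have sumB : \sum_(w : {ffun 'I_p * bool -> X} | w \in family S2) p.+1 <=
    \sum_(w : {ffun 'I_p * bool -> X} | w \in family S2) B w.
  by apply: leq_sum => w _; apply: badpairs_double.
have cardf : #|family S2| = L ^ #|{: 'I_p * bool}|.
  rewrite card_family foldrE big_image /= (eq_bigr (fun _ => L)) //.
  by rewrite prod_nat_const.
rewrite sum_nat_const cardf in sumB.
have P0 : 0 < L ^ #|{: 'I_p * bool}| by rewrite expn_gt0 L_gt0.
rewrite -(leq_pmul2l P0) mulnA (leq_trans (leq_mul sumB (leqnn _))) //.
rewrite /B big_split mulnDl mulnDr /=; apply: leq_add.
  rewrite exchange_big big_distrl big_distrr /=; apply: leq_sum => i _.
  by rewrite (family_two_point (fun x y => col i x == col i y : nat) _ S2L) ?xpair_eqE ?andbF //.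
rewrite exchange_big big_distrl /= mulnCA !big_distrr /=; apply: leq_sum => i _.
rewrite exchange_big big_distrl /= !big_distrr /=; apply: leq_sum => j ij.
rewrite /nontrans exchange_big big_distrl /=.
rewrite (eq_bigr (fun=> L ^ #|{: 'I_p * bool}| * W i j)); last first.
  move=> [b b'] _ /=.
  rewrite (family_two_point (fun x y => ~~ t (col i x) (col j y) : nat) _ S2L) //.
  by apply: contraTneq ij => -[-> _]; rewrite ltnn.
by rewrite sum_nat_const card_prod card_bool mulnCA.
Qed.

(** In each class no colour is shared by more vertices than the majority colour [m i], so there are
    at most [L] times as many coincidences as vertices of that colour. Over the [p] classes this is
    [p * L ^ 2] minus [L] times the number of minority vertices, to be set against
    [p.+1 * L ^ 2]. *)
Lemma doubling_majority :
  exists m : {ffun 'I_p -> V},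
    L * (L + \sum_i #|[set x in S i | col i x != m i]|) <=
    4 * \sum_(i : 'I_p) \sum_(j : 'I_p | i < j) W i j.
Proof.
have /fin_all_exists[m mP] : forall i, exists v, forall x, x \in S i ->
    #|[set y in S i | col i x == col i y]| <= #|[set y in S i | col i y == v]|.
  move=> i; have /card_gt0P[x0 x0S] : 0 < #|S i| by rewrite SL.
  exists [arg max_(v > col i x0) #|[set y in S i | col i y == v]|].
  case: arg_maxnP => // v _ vmax x xS; apply: leq_trans (vmax (col i x) isT).
  by apply: subset_leq_card; apply/subsetP=> y; rewrite !inE eq_sym.
exists (finfun m).
set K := \sum_i _; set WW := \sum_(i < p) _.
have avg := doubling_average.
have : \sum_i \sum_(x in S i) \sum_(y in S i) (col i x == col i y) + L * K
    <= \sum_(i : 'I_p) L * L.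
  rewrite /K big_distrr -big_split /=; apply: leq_sum => i _.
  have -> : L * L = \sum_(x in S i) #|[set y in S i | col i y == m i]|
      + L * #|[set x in S i | col i x != finfun m i]|.
    rewrite sum_nat_const SL -mulnDr; congr (_ * _); rewrite ffunE -(SL i).
    rewrite -(cardsID [set y | col i y == m i]); congr (_ + _);
      by apply: eq_card => y; rewrite !inE // andbC.
  rewrite leq_add2r; apply: leq_sum => x xS; apply: leq_trans (mP i x xS).
  rewrite -sum1_card big_mkcond [X in _ <= X]big_mkcond /=.
  by apply: leq_sum => y _; rewrite inE; case: (y \in S i); case: (_ == _).
rewrite sum_nat_const card_ord; move: avg.
rewrite -/WW; move: (\sum_i _) => C; rewrite mulSn mulnn mulnDr mulnn; lia.
Qed.

End DoublingAverage.

(** * Adding arcs without creating short cycles *)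

Definition short_cycle_free (T : finType) (a : rel T) (h : nat) : Prop :=
  forall c : seq T, 2 < size c <= h -> ~~ ucycleb a c.

Fixpoint ball (T : finType) (a : rel T) (k : nat) (x : T) : {set T} :=
  if k is k'.+1 then ball a k' x :|: \bigcup_(z in ball a k' x) [set y | a z y]
  else [set x].

Lemma card_ball (T : finType) (a : rel T) d k x :
  (forall z, #|[set y | a z y]| <= d) -> #|ball a k x| <= d.+1 ^ k.
Proof.
move=> ad; elim: k => [|k IH] /=; first by rewrite cards1.
rewrite expnS mulSn (leq_trans (leq_card_setU _ _)) // leq_add //.
rewrite mulnC (leq_trans _ (leq_mul IH (leqnn d))) // -sum_nat_const.
apply: (@leq_trans (\sum_(z in ball a k x) #|[set y | a z y]|)); last exact: leq_sum.
elim/big_rec2: _ => [|z n B _ le]; first by rewrite cards0.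
by rewrite (leq_trans (leq_card_setU _ _)) // leq_add2l.
Qed.

Lemma last_ball (T : finType) (a : rel T) k x s :
  path a x s -> size s <= k -> last x s \in ball a k x.
Proof.
elim: k s => [|k IH] s; first by case: s => //= _ _; rewrite inE.
case/lastP: s => [|s y]; first by move=> _ _; rewrite inE IH.
rewrite rcons_path size_rcons last_rcons ltnS => /andP[pxs lxy] sk.
by rewrite inE; apply/orP; right; apply/bigcupP; exists (last x s);
  rewrite ?inE ?IH.
Qed.

Lemma underlying_sym (T : finType) (e : rel T) : symmetric (underlying e).
Proof. by move=> x y; rewrite /underlying orbC. Qed.

(* A short cycle through the new edge closes a short old path joining its ends. *)
Lemma short_cycle_free_add (T : finType) (a a' : rel T) h u v :
  symmetric a ->
  (forall x y, a' x y -> [|| a x y, (x == u) && (y == v) | (x == v) && (y == u)]) ->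
  v \notin ball a h.-1 u -> short_cycle_free a h -> short_cycle_free a' h.
Proof.
move=> syma aa' vu scf c szc; apply/negP => /andP[cyc unc].
have [cyca|/negP ncyca] := boolP (cycle a c).
  by have /negP[] := scf c szc; rewrite /ucycleb cyca.
apply: ncyca; apply: cycle_from_next => // x xc.
apply: contraTT (next_cycle cyc xc) => nax; apply/negP => a'x.
have := aa' _ _ a'x; rewrite (negPf nax) /=.
(* The cycle is rotated to start with the new edge from [x] to [y]. Uniqueness keeps the rest of it
   off that edge, so the rest is a path in [a]. *)
have [i s rc] := rot_to xc.
have nx : next (x :: s) x = next c x by rewrite -rc next_rot.
have unr : uniq (x :: s) by rewrite -rc rot_uniq.
have cycr : cycle a' (x :: s) by rewrite -rc rot_cycle.
have szr : 2 < size (x :: s) <= h by rewrite -rc size_rot.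
move: nax; rewrite -nx; case: s unr cycr szr {rc nx} => [|y s] //= unr cycr szr.
rewrite !eqxx => nay xyuv.
have {}aa' z w : a' z w -> [|| a z w, (z == x) && (w == y) | (z == y) && (w == x)].
  by move/aa'; case/orP: xyuv => /andP[/eqP-> /eqP->] //; rewrite [X in _ || X]orbC.
move: unr; rewrite inE negb_or => /andP[/andP[xy xs] /andP[ys us]].
move: cycr; rewrite rcons_path => /and3P[_ pys lsx].
have s0 : s != [::] by case: (s) szr.
have ls : last y s \in s by case: (s) s0 => //= z s' _; rewrite mem_last.
have pa : path a y (rcons s x).
  rewrite rcons_path; apply/andP; split.
    apply: (sub_in_path (P := predC1 x)) pys.
      move=> z w; rewrite !inE => zx wx /aa'.
      by rewrite (negPf zx) (negPf wx) andbF !orbF.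
    by rewrite /= eq_sym xy /=; apply/allP => z zs; rewrite inE; apply: contraNneq xs => <-.
  have ly : last y s != y by apply: contraNneq ys => <-.
  by have := aa' _ _ lsx; rewrite (negPf xy) (negPf ly) andbF orbF.
have le : size (rcons s x) <= h.-1 by rewrite size_rcons; case/andP: szr => _; case: (h).
case/orP: xyuv => /andP[/eqP xu /eqP yv]; last first.
  by move: (last_ball pa le); rewrite last_rcons xu yv (negPf vu).
(* This path leads from [v] to [u]; symmetry of [a] lets it be read backwards, starting at [u]. *)
have pr : path a x (rcons (rev s) y).
  have := rev_path a y (rcons s x); rewrite last_rcons belast_rcons rev_cons => ->.
  by rewrite (eq_path (e' := a)) // => z w; rewrite syma.
have : size (rcons (rev s) y) <= h.-1 by rewrite size_rcons size_rev -(size_rcons s x).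
by move/(last_ball pr); rewrite last_rcons xu yv (negPf vu).
Qed.

(** * The arc process and conditional expectations *)

Section ArcProcess.

Variables (p N Delta h : nat) (D : finType) (t : rel D).
Local Notation V := ('I_p * 'I_N)%type.
Implicit Types (A : {set V * V}) (G : {ffun V -> option D}) (i j : 'I_p).

Definition arc_of A : rel V := fun u v => (u, v) \in A.

Definition outdeg A u := #|[set v | arc_of A u v]|.
Definition indeg A v := #|[set u | arc_of A u v]|.

Definition class_arcs i j : {set V * V} := [set a | (a.1.1 == i) && (a.2.1 == j)].

Definition admissible A : Prop :=
  [/\ forall u v, arc_of A u v -> u.1 < v.1,
      forall u, outdeg A u <= Delta,
      forall u, indeg A u <= Delta
    & short_cycle_free (underlying (arc_of A)) h].

Definition saturated A v := (Delta <= outdeg A v) || (Delta <= indeg A v).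

(* A partial colouring [G], [None] standing for an uncoloured vertex. *)
Definition violated G (a : V * V) : bool :=
  if (G a.1, G a.2) is (Some x, Some y) then ~~ t x y else false.

(** Coloured vertices must be unsaturated so that the degree bound never refuses an arc violating a
    live [G]; only closeness can. *)
Definition alive A G : bool :=
  [forall v, (G v != None) ==> ~~ saturated A v]
  && [forall a in A, ~~ violated G a].

Definition allowed A (a : V * V) : bool :=
  [&& outdeg A a.1 < Delta, indeg A a.2 < Delta
    & a.2 \notin ball (underlying (arc_of A)) h.-1 a.1].

(** A refused pair leaves [A] unchanged, so one step can be averaged over all of
    [class_arcs i j]. *)
Definition add_arc A a := if allowed A a then a |: A else A.

Definition nviolated G i j := #|[set a in class_arcs i j | violated G a]|.

(** An upper bound for the close pairs between two classes: [N] first ends, each with a ball in a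
    graph of maximum degree at most [Delta.*2]. *)
Definition nclose := N * (Delta.*2.+1) ^ h.

Lemma sub_add_arc A a : A \subset add_arc A a.
Proof. by rewrite /add_arc; case: ifP => // _; apply: subsetUr. Qed.

Lemma outdegS A (B : {set V * V}) u : A \subset B -> outdeg A u <= outdeg B u.
Proof.
by move=> /subsetP AB; apply/subset_leq_card/subsetP => v; rewrite !inE; apply: AB.
Qed.

Lemma indegS A (B : {set V * V}) u : A \subset B -> indeg A u <= indeg B u.
Proof.
by move=> /subsetP AB; apply/subset_leq_card/subsetP => v; rewrite !inE; apply: AB.
Qed.

Lemma aliveS A (B : {set V * V}) G : A \subset B -> alive B G -> alive A G.
Proof.
move=> AB /andP[/forallP ns /forall_inP nv]; apply/andP; split.
  apply/forallP => v; apply/implyP => /(implyP (ns v)); apply: contra.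
  case/orP => le; apply/orP; [left | right]; apply: leq_trans le _.
    exact: outdegS.
  exact: indegS.
by apply/forall_inP => a aA; apply: nv; apply: (subsetP AB).
Qed.

Lemma add_arc_admissible A a i j :
  i < j -> a \in class_arcs i j -> admissible A -> admissible (add_arc A a).
Proof.
case: a => u v ij; rewrite inE /= => /andP[/eqP ui /eqP vj].
rewrite /add_arc; case: ifP => // /and3P[/= du dv nb] [lt dout din scf].
have arcU x y : arc_of ((u, v) |: A) x y = (x == u) && (y == v) || arc_of A x y.
  by rewrite /arc_of !inE xpair_eqE.
split.
- by move=> x y; rewrite arcU => /orP[/andP[/eqP-> /eqP->]|/lt//]; rewrite ui vj.
- move=> x; have [->|xu] := eqVneq x u.
    apply: leq_trans du; rewrite -add1n -(cards1 v) (leq_trans _ (leq_card_setU _ _)) //.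
    apply/subset_leq_card/subsetP => y; rewrite !inE arcU.
    by case/orP => [/andP[_ ->]//|->]; rewrite orbT.
  rewrite (leq_trans _ (dout x)) //; apply/subset_leq_card/subsetP => y.
  by rewrite !inE arcU (negPf xu).
- move=> x; have [->|xv] := eqVneq x v.
    apply: leq_trans dv; rewrite -add1n -(cards1 u) (leq_trans _ (leq_card_setU _ _)) //.
    apply/subset_leq_card/subsetP => y; rewrite !inE arcU.
    by case/orP => [/andP[->]//|->]; rewrite orbT.
  rewrite (leq_trans _ (din x)) //; apply/subset_leq_card/subsetP => y.
  by rewrite !inE arcU (negPf xv) andbF.
apply: (short_cycle_free_add _ _ nb scf); first exact: underlying_sym.
move=> x y; rewrite /underlying !arcU.
by case: (arc_of A x y); case: (arc_of A y x); case: (x == u); case: (y == v);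
  case: (x == v); case: (y == u).
Qed.

Lemma card_class_arcs i j : #|class_arcs i j| = N ^ 2.
Proof.
pose f (k : 'I_N * 'I_N) : V * V := ((i, k.1), (j, k.2)).
have -> : class_arcs i j = f @: setT.
  apply/setP => -[[i' x] [j' y]]; rewrite inE /=; apply/andP/imsetP.
    by case=> /eqP-> /eqP->; exists (x, y).
  by case=> [[x' y'] _ [-> _ -> _]].
rewrite card_imset; last by case=> [x y] [x' y'] [-> ->].
by rewrite cardsT card_prod !card_ord mulnn.
Qed.

Lemma card_close A i j : admissible A ->
  #|[set a in class_arcs i j | a.2 \in ball (underlying (arc_of A)) h.-1 a.1]| <= nclose.
Proof.
case=> _ dout din _; set E := [set a in _ | _].
pose B k := ball (underlying (arc_of A)) h.-1 (i, k).
have sub : E \subset \bigcup_(k : 'I_N) [set ((i, k), v) | v in B k].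
  apply/subsetP => -[[i' k] v]; rewrite !inE /= -andbA => /and3P[/eqP -> _ vB].
  by apply/bigcupP; exists k => //; apply/imsetP; exists v.
rewrite (leq_trans (subset_leq_card sub)) //.
apply: (@leq_trans (\sum_(k : 'I_N) #|B k|)).
  elim/big_rec2: _ => [|k n C _ le]; first by rewrite cards0.
  by rewrite (leq_trans (leq_card_setU _ _)) // leq_add ?leq_imset_card.
rewrite /nclose -[N in X in _ <= X]card_ord -sum_nat_const; apply: leq_sum => k _.
apply: (@leq_trans (Delta.*2.+1 ^ h.-1)); last by rewrite leq_pexp2l ?leq_pred.
apply: card_ball => z; rewrite -addnn (leq_trans _ (leq_add (dout z) (din z))) //.
rewrite (leq_trans _ (leq_card_setU _ _)) //.
by apply/subset_leq_card/subsetP => y; rewrite !inE.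
Qed.

(** A violated pair after which [G] is still alive was refused; its ends being coloured, hence
    unsaturated, it was refused for closeness. So the two counted sets meet in close pairs only. *)
Lemma card_add_arc_alive A G i j : admissible A -> alive A G ->
  #|[set a in class_arcs i j | alive (add_arc A a) G]| + nviolated G i j
  <= N ^ 2 + nclose.
Proof.
move=> admA alG; rewrite -(card_class_arcs i j) /nviolated.
set X := [set a in _ | alive _ _]; set Y := [set a in _ | violated _ _].
rewrite -cardsUI leq_add //.
  by apply/subset_leq_card/subsetP => a; rewrite !inE => /orP[] /andP[].
apply: leq_trans (card_close i j admA); apply/subset_leq_card/subsetP => a.
rewrite !inE => /andP[/andP[aP alX] /andP[_ vio]]; rewrite aP /=.
apply: contraLR vio => nclose_a.
case/andP: alX => _ /forall_inP nv; apply/negP => vio.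
have /andP[/forallP ns _] := alG.
have nsat b : G b != None -> ~~ saturated A b by move=> ?; apply: (implyP (ns b)).
have ok : allowed A a.
  have [n1 n2] : G a.1 != None /\ G a.2 != None.
    by move: vio; rewrite /violated; case: (G a.1); case: (G a.2).
  move: (nsat _ n1) (nsat _ n2); rewrite /saturated !negb_or -!ltnNge.
  by rewrite /allowed nclose_a => /andP[-> _] /andP[_ ->].
by have := nv a; rewrite /add_arc ok setU11 vio => /(_ isT).
Qed.

Lemma card_add_arc_class A a i j i' j' : a \in class_arcs i j ->
  #|add_arc A a :&: class_arcs i' j'| <=
  ((i, j) == (i', j')) + #|A :&: class_arcs i' j'|.
Proof.
rewrite inE => /andP[/eqP ai /eqP aj]; rewrite /add_arc.
case: ifP => _; last exact: leq_addl.
rewrite setIUl (leq_trans (leq_card_setU _ _)) // leq_add2r.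
case: eqP => [_|ne]; first by rewrite (leq_trans (subset_leq_card (subsetIl _ _))) ?cards1.
rewrite leqn0 cards_eq0; apply/eqP/setP => b; rewrite !inE.
apply/negP => /and3P[/eqP -> /eqP b1 /eqP b2]; apply: ne.
by rewrite -ai -aj b1 b2.
Qed.

Import Order.TTheory GRing.Theory Num.Theory.
Variable R : realType.
Local Open Scope ring_scope.

(* A lower bound, possibly negative, for the proportion of the pairs joining
   the classes [q.1] and [q.2] whose addition kills a live [G]. *)
Definition kill_rate G (q : 'I_p * 'I_p) : R :=
  ((nviolated G q.1 q.2)%:R - nclose%:R) / (N ^ 2)%:R.

Variable Gs : {set {ffun V -> option D}}.

(** At most the proportion [1 - kill_rate] of the pairs leaves a given live [G] alive, and this is
    at most [expR (- kill_rate)]. Some pair does no worse than the average. *)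
Lemma step_exists A i j (w : {ffun V -> option D} -> R) :
  (0 < N)%N -> admissible A -> (forall G, 0 <= w G) ->
  exists2 a, a \in class_arcs i j &
    \sum_(G in Gs | alive (add_arc A a) G) w G <=
    \sum_(G in Gs | alive A G) w G * expR (- kill_rate G (i, j)).
Proof.
move=> N0 admA w0.
pose X := \sum_(G in Gs | alive A G) w G * expR (- kill_rate G (i, j)).
case: (pickP [pred a | (a \in class_arcs i j) &&
   (\sum_(G in Gs | alive (add_arc A a) G) w G <= X)]) => [a /andP[] | none].
  by exists a.
have N20 : (0 : R) < (N ^ 2)%:R by rewrite ltr0n expn_gt0 N0.
have : \sum_(a in class_arcs i j) X <
    \sum_(a in class_arcs i j) \sum_(G in Gs | alive (add_arc A a) G) w G.
  apply: ltr_sum.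
    have /card_gt0P[a aP] : (0 < #|class_arcs i j|)%N by rewrite card_class_arcs expn_gt0 N0.
    by apply/hasP; exists a; rewrite ?mem_index_enum.
  by move=> a aP; move: (none a); rewrite /= aP /= real_leNgt ?num_real // => /negbFE.
rewrite sumr_const card_class_arcs -mulr_natl ltNge => /negP[].
rewrite (exchange_big_dep (mem Gs)) /=; last by move=> a G _ /andP[].
rewrite /X big_distrr /= [X in X <= _](bigID (alive A)) /=.
rewrite [X in _ + X]big1 ?addr0; last first.
  move=> G /andP[_ nal]; rewrite big1 // => a /andP[_ /andP[_]] /(aliveS (sub_add_arc A a)).
  by rewrite (negPf nal).
apply: ler_sum => G /andP[GG alG].
rewrite sumr_const mulrCA -[w G *+ _]mulr_natr ler_wpM2l //.
rewrite (le_trans (y := (N ^ 2)%:R * (1 - kill_rate G (i, j)))) //; last first.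
  by rewrite (ler_wpM2l (ltW N20)) ?expR_ge1Dx.
rewrite mulrBr mulr1 /kill_rate [X in _ - X]mulrC divfK ?gt_eqF // opprB /=.
rewrite addrA lerBrDr -!natrD ler_nat.
rewrite (leq_trans _ (card_add_arc_alive i j admA alG)) // leq_add2r.
by apply/subset_leq_card/subsetP => a /and3P[aP _ al]; rewrite inE aP.
Qed.

(** The potential weighs each live [G] by an estimate of its survival through the remaining
    schedule, and each arc can be chosen so as not to increase it. When the schedule is exhausted a
    live [G] weighs 1, so a potential below 1 leaves none. *)
Lemma process_exists (ts : seq ('I_p * 'I_p)) A :
  (0 < N)%N -> admissible A -> (forall q, q \in ts -> q.1 < q.2)%N ->
  \sum_(G in Gs | alive A G) expR (- \sum_(q <- ts) kill_rate G q) < 1 ->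
  exists A', [/\ admissible A',
    forall i j, (#|A' :&: class_arcs i j| <=
      #|A :&: class_arcs i j| + count_mem (i, j) ts)%N
    & forall G, G \in Gs -> ~~ alive A' G].
Proof.
move=> N0; elim: ts A => [|[i j] ts IH] A admA lts lt1.
  exists A; split=> [//|i j|G GG]; first by rewrite addn0.
  apply/negP => alG; move: lt1; rewrite ltNge => /negP[].
  rewrite (bigD1 G) /= ?GG // big_nil oppr0 expR0 lerDl.
  by apply: sumr_ge0 => *; apply: expR_ge0.
have ij : (i < j)%N by apply: (lts (i, j)); rewrite inE eqxx.
have [a aP le] := step_exists (w := fun G => expR (- \sum_(q <- ts) kill_rate G q))
  i j N0 admA (fun G => expR_ge0 _).
have [||| A' [adm' card' dead]] := IH (add_arc A a).
- exact: add_arc_admissible ij aP admA.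
- by move=> q qts; apply: lts; rewrite inE qts orbT.
- apply: le_lt_trans le _; apply: le_lt_trans lt1; apply: ler_sum => G _.
  by rewrite big_cons -expRD -opprD addrC.
exists A'; split=> // i' j'; apply: leq_trans (card' i' j') _.
rewrite /= addnA leq_add2r addnC; exact: card_add_arc_class.
Qed.

End ArcProcess.

Import Order.TTheory GRing.Theory Num.Theory.
(** * The sparse graph *)

Lemma expRN_le (R : realType) (k : nat) (r : R) :
  (k%:R <= r -> expR (- r) <= 2^-1 ^+ k)%R.
Proof.
move=> kr; apply: (@le_trans _ _ (expR (- 1) ^+ k)%R).
  by rewrite -expRM_natl ler_expR mulrN mulr1 lerN2.
rewrite lerXn2r ?nnegrE ?expR_ge0 ?invr_ge0 ?ler0n //.
rewrite expRN lef_pV2 ?posrE ?expR_gt0 ?ltr0n //.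
exact: (expR_ge1Dx (1 : R)%R).
Qed.

Lemma card_class_arcs_sum p N (i j : 'I_p) (P : pred (('I_p * 'I_N) * ('I_p * 'I_N))) :
  #|[set a in class_arcs N i j | P a]| =
  \sum_(k : 'I_N) \sum_(l : 'I_N) P ((i, k), (j, l)).
Proof.
pose f (q : 'I_N * 'I_N) := ((i, q.1), (j, q.2)).
have -> : [set a in class_arcs N i j | P a] = f @: [set q | P (f q)].
  apply/setP => -[[i' x] [j' y]]; rewrite !inE /=; apply/idP/imsetP.
    by case/andP=> /andP[/eqP-> /eqP->] Pa; exists (x, y); rewrite ?inE.
  by case=> [[x' y']]; rewrite inE => Pf [-> -> -> ->]; rewrite !eqxx.
rewrite card_imset; last by case=> [x y] [x' y'] [-> ->].
rewrite -sum1_card pair_big /= big_mkcond /=; apply: eq_bigr => q _.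
by rewrite inE; case: (P _).
Qed.

Section SparseGraph.

Variables (p L h : nat) (D : finType) (t : rel D) (d0 : D).
Hypothesis tt : tournament t.
Hypothesis no_trans : forall s, size s = p -> ~~ pairwise t s.
Hypothesis p_gt1 : 1 < p.
Hypothesis D_small : #|D| < 2 ^ p.
Hypothesis p_le_L : p <= L.

Let Delta := 96 * p * p.-1.
Hypothesis L_large : 48 * p ^ 2 * (Delta.*2.+1) ^ h <= L.

Let N := L.*2.
Let V := ('I_p * 'I_N)%type.

(** A class takes part in [p.-1] pairs of classes, so at most [rounds * p.-1 = L * Delta] arcs meet
    it, and at most [L] of its [N] vertices become saturated. *)
Let rounds := 96 * p * L.
Let types := [seq q : 'I_p * 'I_p <- enum {: 'I_p * 'I_p} | q.1 < q.2].
Let schedule := flatten (nseq rounds types).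

Let Gs : {set {ffun V -> option D}} :=
  [set G : {ffun V -> option D} | [forall i, #|[set k | G (i, k) != None]| == L]].

Let off (G : {ffun V -> option D}) (m : {ffun 'I_p -> D}) (v : V) : bool :=
  (G v != None) && (G v != Some (m v.1)).

(** This is [doubling_majority] for the coloured vertices; [d0] stands in for uncoloured ones, which
    lie outside [S i]. *)
Lemma sum_nviolated G : G \in Gs ->
  exists m, L * (L + \sum_v off G m v) <=
    4 * \sum_(i : 'I_p) \sum_(j : 'I_p | i < j) nviolated t G i j.
Proof.
rewrite inE => /forallP GS.
pose S i := [set k | G (i, k) != None].
pose col i k := odflt d0 (G (i, k)).
have SL i : #|S i| = L by apply/eqP/(GS i).
have L_gt0 : 0 < L by apply: leq_trans p_le_L; apply: ltnW.
have [m le] := doubling_majority col tt no_trans L_gt0 SL.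
exists m.
have -> : \sum_v off G m v = \sum_i #|[set x in S i | col i x != m i]|.
  rewrite (eq_bigr (fun v => off G m (v.1, v.2) : nat)); last by case.
  rewrite -(pair_big predT predT (fun i k => (off G m (i, k) : nat))) /=.
  apply: eq_bigr => i _; rewrite -sum1_card big_mkcond [RHS]big_mkcond /=.
  apply: eq_bigr => k _; rewrite /off !inE /col /=.
  by case: (G (i, k)) => //= x; rewrite (inj_eq Some_inj); case: (x == _).
apply: leq_trans le _; rewrite leq_mul2l /=; apply: leq_sum => i _.
apply: leq_sum => j _; rewrite /nviolated card_class_arcs_sum big_mkcond /=.
apply: leq_sum => k _; rewrite inE; case Gk: (G (i, k)) => [x|] //=.
rewrite big_mkcond; apply: leq_sum => l _; rewrite inE /violated /= Gk /col Gk.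
by case: (G (j, l)).
Qed.

(** With [K] the number of [off] vertices, the violated pairs give at least [rounds * L * (L + K) /
    (4 * N ^ 2) = 6 * p * (L + K)]. By [L_large] the close pairs cost at most [p * L]. *)
Lemma kill_rate_sum (R : realType) G : G \in Gs ->
  exists m, ((5 * p * (L + \sum_v off G m v))%:R <=
    \sum_(q <- schedule) kill_rate Delta h t R G q)%R.
Proof.
move=> /sum_nviolated[m le]; exists m; move: le.
set K := \sum_v _; set W := \sum_(i < p) _ => le.
have L_gt0 : 0 < L by apply: leq_trans p_le_L; apply: ltnW.
have N2 : (0 < (N ^ 2)%:R :> R)%R by rewrite ltr0n expn_gt0 /N double_gt0 L_gt0.
have -> : (\sum_(q <- schedule) kill_rate Delta h t R G q =
    rounds%:R * \sum_(q <- types) kill_rate Delta h t R G q)%R.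
  rewrite /schedule big_flatten /= big_nseq; elim: rounds => [|r IH] /=.
    by rewrite mul0r.
  by rewrite IH -[r.+1]add1n natrD mulrDl mul1r.
rewrite /kill_rate -mulr_suml mulrA ler_pdivlMr // sumrB.
rewrite big_const_seq iter_addr_0 -!natrM -natr_sum.
have -> : \sum_(q <- types) nviolated t G q.1 q.2 = W.
  rewrite /types big_filter big_enum_cond /= /W.
  by rewrite (pair_big_dep predT (fun i j : 'I_p => i < j) (fun i j => nviolated t G i j)).
rewrite mulrBr lerBrDr -mulrnA -!natrM -natrD ler_nat.
set F := nclose _ _ _; set c := count _ _.
have cp : c <= p ^ 2.
  by rewrite (leq_trans (count_size _ _)) // size_filter (leq_trans (count_size _ _)) //
    -cardE card_prod !card_ord mulnn.
have FL : 24 * p ^ 2 * F <= L * L.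
  rewrite /F /nclose /N.
  have -> : 24 * p ^ 2 * (L.*2 * Delta.*2.+1 ^ h) = L * (48 * p ^ 2 * Delta.*2.+1 ^ h).
    by rewrite -mul2n; ring.
  by rewrite leq_mul2l L_large orbT.
rewrite /rounds /N.
apply: (@leq_trans (20 * p * L * L * (L + K) + 4 * p * L * (24 * p ^ 2 * F))).
  rewrite leq_add //.
    by rewrite leq_eqVlt; apply/orP; left; apply/eqP; rewrite -mul2n; ring.
  have -> : 4 * p * L * (24 * p ^ 2 * F) = 96 * p * L * (p ^ 2 * F) by ring.
  by rewrite leq_mul // mulnC leq_mul.
apply: (@leq_trans (24 * p * L * (L * (L + K)))).
  have -> : 24 * p * L * (L * (L + K)) =
      20 * p * L * L * (L + K) + 4 * p * L * (L * (L + K)) by ring.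
  by rewrite leq_add2l leq_mul2l (leq_trans FL) ?orbT // leq_mul // leq_addr.
have -> : 96 * p * L * W = 24 * p * L * (4 * W) by ring.
by rewrite leq_mul2l le orbT.
Qed.

(** As [m] depends on [G], the bound is summed over all [m]; for fixed [m] the sum over all partial
    colourings factors over the vertices. Each vertex contributes at most 3: one for no colour, one
    for its colour under [m], and at most one for all other colours together, each of weight [x]. *)
Lemma total_weight (R : realType) :
  (\sum_(G in Gs) expR (- \sum_(q <- schedule) kill_rate Delta h t R G q) < 1)%R.
Proof.
pose y : R := (2^-1 ^+ (5 * p * L))%R.
pose x : R := (2^-1 ^+ (5 * p))%R.
have y0 : (0 <= y)%R by rewrite exprn_ge0 // invr_ge0 ler0n.
have x0 : (0 <= x)%R by rewrite exprn_ge0 // invr_ge0 ler0n.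
pose wt (m : {ffun 'I_p -> D}) (v : V) (o : option D) : R :=
  if (o != None) && (o != Some (m v.1)) then x else 1%R.
have wt0 m v o : (0 <= wt m v o)%R by rewrite /wt; case: ifP.
have leG G : G \in Gs -> (expR (- \sum_(q <- schedule) kill_rate Delta h t R G q) <=
    \sum_(m : {ffun 'I_p -> D}) y * \prod_v wt m v (G v))%R.
  case/(kill_rate_sum R) => m le; rewrite (bigD1 m) //= ler_wpDr //.
    by apply: sumr_ge0 => m' _; rewrite mulr_ge0 // prodr_ge0.
  apply: le_trans (expRN_le le) _; rewrite mulnDr exprD ler_wpM2l //.
  rewrite exprM -/x -prodrXr; apply: ler_prod => v _.
  by rewrite /wt -/(off G m v) exprn_ge0 //=; case: (off G m v).
have row_le m v : (\sum_o wt m v o <= 3)%R.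
  rewrite (bigD1 None) // (bigD1 (Some (m v.1))) //= {1 2}/wt eqxx /= addrA.
  rewrite (_ : 3 = 1 + 1 + 1)%R ?lerD2l; last by ring.
  rewrite (eq_bigr (fun=> x)) => [|o on]; last by rewrite /wt on.
  rewrite sumr_const -mulr_natl.
  have -> : x = ((2 ^ (5 * p))%:R^-1 : R)%R by rewrite natrX -exprVn.
  rewrite ler_pdivrMr ?ltr0n ?expn_gt0 // mul1r ler_nat.
  apply: (@leq_trans #|{: option D}|); first exact: max_card.
  rewrite card_option (leq_trans D_small) // leq_exp2l // leq_pmull //.
apply: (@le_lt_trans _ _ (y * 3 ^+ #|{: V}| *+ #|{ffun 'I_p -> D}|)%R).
  rewrite -sumr_const; apply: le_trans (ler_sum _ leG) _.
  rewrite exchange_big /=; apply: ler_sum => m _.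
  rewrite -mulr_sumr ler_wpM2l //.
  apply: (@le_trans _ _ (\sum_(G : {ffun V -> option D}) \prod_v wt m v (G v))%R).
    rewrite big_mkcond; apply: ler_sum => G _; case: ifP => // _.
    by rewrite prodr_ge0.
  rewrite -bigA_distr_bigA -prodr_const; apply: ler_prod => v _.
  by rewrite row_le sumr_ge0.
have -> : y = ((2 ^ (5 * p * L))%:R^-1 : R)%R by rewrite natrX -exprVn.
rewrite -mulr_natr -mulrA ltr_pdivrMl ?ltr0n ?expn_gt0 // mulr1 -natrX -natrM ltr_nat.
rewrite card_ffun card_prod !card_ord mulnC.
have p0 : 0 < p by apply: ltnW.
(* [p <= L] absorbs the number of maps [m]; what remains is [2 * 9 < 2 ^ 5] raised to the power
   [p * L]. *)
apply: (@leq_ltn_trans ((2 ^ p) ^ L * 9 ^ (p * L))).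
  apply: leq_mul.
    apply: (@leq_trans ((2 ^ p) ^ p)); first by rewrite leq_exp2r // ltnW.
    by rewrite leq_exp2l // -[X in X < _](expn0 2) ltn_exp2l.
  by rewrite -[9]/(3 ^ 2) -expnM leq_exp2l // /N -mul2n; lia.
rewrite -expnM -expnMn -mulnA [2 ^ (5 * _)]expnM ltn_exp2r // muln_gt0 p0.
exact: leq_trans p_le_L.
Qed.

Lemma card_set_of_size (T : finType) (A : {set T}) k :
  k <= #|A| -> exists2 B : {set T}, B \subset A & #|B| = k.
Proof.
move=> le; exists [set x in take k (enum A)].
  by apply/subsetP => x; rewrite inE => /mem_take; rewrite mem_enum.
rewrite cardsE (card_uniqP _) ?take_uniq ?enum_uniq //.
by rewrite size_takel // -cardE.
Qed.

(** A homomorphism restricted to [L] unsaturated vertices of each class would be a member of [Gs]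
    still alive at the end of the process. *)
Lemma sparse_graph_exists :
  exists e : rel V,
    [/\ forall u v, e u v -> u.1 < v.1,
        forall u, #|[set v | e u v]| <= Delta,
        forall v, #|[set u | e u v]| <= Delta,
        short_cycle_free (underlying e) h
      & forall f : V -> D, ~ homomorphism e t f].
Proof.
have p0 : 0 < p by apply: ltnW.
have L0 : 0 < L by apply: leq_trans p_le_L.
have N0 : 0 < N by rewrite double_gt0.
have adm0 : admissible Delta h (set0 : {set V * V}).
  split=> [u v|u|u|c szc].
  - by rewrite /arc_of inE.
  - by rewrite /outdeg eq_card0 // => v; rewrite !inE /arc_of inE.
  - by rewrite /indeg eq_card0 // => v; rewrite !inE /arc_of inE.
  by case: c szc => [|x [|y c]] //= _; rewrite /ucycleb /= /underlying /arc_of !inE.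
have lts q : q \in schedule -> q.1 < q.2.
  case/flattenP => s; rewrite mem_nseq => /andP[_ /eqP->].
  by rewrite mem_filter => /andP[].
have [|A [admA cardA dead]] := process_exists (t := t) (Gs := Gs)
  (R := Rdefinitions.R) N0 adm0 lts.
  apply: le_lt_trans (total_weight _).
  rewrite big_mkcondr; apply: ler_sum => G _; case: ifP => // _.
  exact: expR_ge0.
have [lt dout din scf] := admA.
exists (arc_of A); split=> // f hf.
have cardA_le i j : #|A :&: class_arcs N i j| <= rounds * (i < j).
  apply: leq_trans (cardA i j) _; rewrite set0I cards0 add0n.
  rewrite /schedule count_flatten map_nseq sumn_nseq mulnC leq_mul2l.
  apply/orP; right; rewrite /types count_filter.
  case: ltnP => ij.
    apply: (@leq_trans (count_mem (i, j) (enum {: 'I_p * 'I_p}))).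
      by apply: sub_count => q /andP[].
    by rewrite count_uniq_mem ?enum_uniq // leq_b1.
  by rewrite /= leqNgt -has_count; apply/hasPn => q _;
    apply/negP => /andP[/eqP-> /=]; rewrite ltnNge ij.
have cardI i j : #|A :&: class_arcs N i j| =
    \sum_(k : 'I_N) \sum_(l : 'I_N) (((i, k), (j, l)) \in A).
  rewrite -(card_class_arcs_sum i j (mem A)).
  by apply: eq_card => a; rewrite !inE andbC.
have unsat i : L <= #|[set k | ~~ saturated Delta A (i, k)]|.
  set U := [set k | _].
  have -> : L = N - L by rewrite /N -addnn addnK.
  rewrite leq_subLR -[N in N <= _]card_ord -(cardsC U) addnC leq_add2r.
  have D0 : 0 < Delta by rewrite /Delta !muln_gt0 p0 -subn1 subn_gt0.
  rewrite -(leq_pmul2r D0) -sum_nat_const.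
  have sumout : \sum_k outdeg A (i, k) = \sum_j #|A :&: class_arcs N i j|.
    under [RHS]eq_bigr => j _ do rewrite cardI.
    rewrite [RHS]exchange_big; apply: eq_bigr => k _.
    rewrite pair_big /outdeg -sum1_card big_mkcond; apply: eq_bigr => -[j l] _.
    by rewrite inE /arc_of; case: (_ \in A).
  have sumin : \sum_k indeg A (i, k) = \sum_j #|A :&: class_arcs N j i|.
    under [RHS]eq_bigr => j _ do rewrite cardI exchange_big.
    rewrite [RHS]exchange_big; apply: eq_bigr => k _.
    rewrite pair_big /indeg -sum1_card big_mkcond; apply: eq_bigr => -[j l] _.
    by rewrite inE /arc_of; case: (_ \in A).
  apply: (@leq_trans (\sum_k (outdeg A (i, k) + indeg A (i, k)))).
    rewrite big_mkcond; apply: leq_sum => k _; rewrite !inE negbK.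
    case: ifP => // /orP[] le; first exact: leq_trans le (leq_addr _ _).
    exact: leq_trans le (leq_addl _ _).
  rewrite big_split sumout sumin -big_split /=.
  apply: (@leq_trans (\sum_(j | j != i) rounds)).
    rewrite [X in _ <= X]big_mkcond; apply: leq_sum => j _.
    apply: leq_trans (leq_add (cardA_le i j) (cardA_le j i)) _.
    rewrite -mulnDr neq_ltn; case: ltngtP => _; rewrite ?muln0 ?muln1 //.
  rewrite sum_nat_const cardC1 card_ord /rounds /Delta.
  by rewrite leq_eqVlt; apply/orP; left; apply/eqP; ring.
have /fin_all_exists2[S SU SL] i := card_set_of_size (unsat i).
pose G : {ffun V -> option D} :=
  [ffun v => if v.2 \in S v.1 then Some (f v) else None].
have /negP[] : ~~ alive Delta t A G.
  apply: dead; rewrite inE; apply/forallP => i; rewrite -(SL i).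
  by apply/eqP/eq_card => k; rewrite inE ffunE /=; case: (k \in S i).
apply/andP; split.
  apply/forallP => -[i k]; rewrite ffunE /=; apply/implyP.
  by case: ifP => // kS _; have := subsetP (SU i) k kS; rewrite inE.
apply/forall_inP => -[u v] uv; rewrite /violated /= !ffunE.
by case: ifP => // _; case: ifP => // _; rewrite negbK; apply: hf.
Qed.

End SparseGraph.

(** * Components and levelled graphs *)

(** The predicates minimised here quantify over all finite types, so excluded middle takes the place
    of a decision procedure. *)
Lemma well_order_nat (P : nat -> Prop) n :
  P n -> exists2 m, is_least P m & m <= n.
Proof.
elim/ltn_ind: n => n IH Pn.
have [[k kn Pk]|none] := classic (exists2 k, k < n & P k).
  by have [m lm mk] := IH k kn Pk; exists m => //; apply: leq_trans mk (ltnW kn).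
exists n => //; split=> // k Pk; rewrite leqNgt; apply/negP => kn.
by apply: none; exists k.
Qed.

(** Arcs never leave a component, so maps chosen separately on the components would glue to one on
    the whole graph. *)
Lemma component_not_homomorphic (T D : finType) (e : rel T) (t : rel D) :
  (forall f, ~ homomorphism e t f) ->
  exists x0, forall f : {y | connect (underlying e) x0 y} -> D,
    ~ homomorphism (relpre val e) t f.
Proof.
move=> nohom; apply: NNPP => none.
have symU := sym_connect_sym (underlying_sym e).
have /fin_all_exists[F hF] : forall x, exists f : T -> D, forall y z,
    connect (underlying e) x y -> e y z -> t (f y) (f z).
  move=> x; have [[f hf]|nof] := classic (exists f : {y | connect (underlying e) x y} -> D,
     homomorphism (relpre val e) t f); last first.
    by case: none; exists x => f hf; apply: nof; exists f.
  (* Outside the component of [x] the value is a dummy. *)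
  exists (fun y => if insub y is Some a then f a else f (exist _ x (connect0 _ x))).
  move=> y z xy yz.
  have xz : connect (underlying e) x z.
    by apply: connect_trans xy (connect1 _); rewrite /underlying yz.
  by rewrite !insubT; apply: hf.
(* [fingraph.root] selects one vertex per component, so both ends of an arc are mapped by the same
   function. *)
apply: (nohom (fun y => F (fingraph.root (underlying e) y) y)) => x y exy.
have <- : fingraph.root (underlying e) x = fingraph.root (underlying e) y.
  by apply/eqP; rewrite root_connect // connect1 // /underlying exy.
by apply: hF exy; rewrite symU connect_root.
Qed.

Lemma component_connected (T : finType) (e : rel T) x0 :
  Defs.connected (relpre (val : {y | connect (underlying e) x0 y} -> T) e).
Proof.
set e' := relpre _ _.
have conn a : connect (underlying e') (exist _ x0 (connect0 _ x0)) a.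
  case: a => y xy; have /connectP[s pxs ys] := xy.
  elim/last_ind: s y xy pxs ys => [|s z IH] y xy pxs ys.
    by rewrite (_ : exist _ _ _ = exist _ y xy) //; apply: val_inj.
  move: pxs ys; rewrite rcons_path last_rcons => /andP[pxs lz] yz.
  have xl : connect (underlying e) x0 (last x0 s) by apply/connectP; exists s.
  apply: connect_trans (IH _ xl pxs erefl) (connect1 _).
  by rewrite /underlying /e' /= yz.
move=> a b; apply: connect_trans (conn b).
by rewrite (sym_connect_sym (underlying_sym e')); apply: conn.
Qed.

(** A source [None] is added to [D]. Once the first vertex of a transitive subtournament of order
    [p] is dropped, the others have an in-neighbour and therefore lie in [D]. *)
Lemma trans_pred_of_ramsey (D : finType) (t : rel D) p :
  0 < p -> tournament t ->
  (forall (V : finType) (t' : rel V), #|V| = #|D|.+1 -> tournament t' ->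
     exists f : 'I_p -> V, injective f /\ homomorphism (@trans_tournament p) t' f) ->
  exists2 s, size s = p.-1 & pairwise t s.
Proof.
move=> p0 [irr tot] ram.
pose t' (a b : option D) := match a, b with
  | Some x, Some y => t x y | None, Some _ => true | _, None => false end.
have tt' : tournament t' by split=> [[x|]|[x|] [y|]] //= xy; apply: tot.
have [f [_ hf]] := ram (option D) t' (card_option D) tt'.
have [[|x s] sz] := trans_tournament_pairwise hf; first by rewrite -sz in p0.
case/andP=> xs ps.
have [s' sE] : exists s', s = map Some s'.
  exists (pmap id s); elim: s xs {sz ps} => //= -[y|] s IH /andP[]; last by case: x {IH}.
  by move=> _ /IH {1}->.
exists s'; first by rewrite -sz /= sE size_map.
by move: ps; rewrite -/(pairwise t' s) sE pairwise_map.
Qed.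

Section LevelledGraph.

Variables (T : finType) (e : rel T) (lvl : T -> nat).
Hypothesis lvlE : forall x y, e x y -> lvl x < lvl y.

Lemma levelled_path x s : path e x s -> all (fun y => lvl x < lvl y) s.
Proof.
move=> pxs; have : path (relpre lvl ltn) x s by apply: sub_path pxs => y z /lvlE.
by apply: order_path_min => y x' z /=; apply: ltn_trans.
Qed.

Lemma levelled_acyclic : acyclic e.
Proof.
case=> // x s _; apply/negP => /andP[/levelled_path/allP/(_ x)].
by rewrite mem_rcons inE eqxx ltnn => /(_ isT).
Qed.

Lemma levelled_oriented : oriented e.
Proof.
split=> [x|x y /lvlE xy]; first by apply/negP => /lvlE; rewrite ltnn.
by apply/negP => /lvlE /(ltn_trans xy); rewrite ltnn.
Qed.

Lemma levelled_sorted s : sorted e s -> sorted ltn (map lvl s).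
Proof. by rewrite sorted_map; apply: sub_sorted => x y /lvlE. Qed.

Lemma levelled_uniq s : sorted e s -> uniq s.
Proof.
move=> /levelled_sorted /(sorted_uniq ltn_trans ltnn); exact: map_uniq.
Qed.

Lemma leq_path_order s : sorted e s -> size s <= path_order e.
Proof.
move=> es; have us := levelled_uniq es.
have lt : size s < #|T|.+1.
  by rewrite ltnS -(card_uniqP us); apply: max_card.
apply: (@leq_bigmax_cond _ _ _ (Ordinal lt)).
by apply/existsP; exists (in_tuple s); rewrite us.
Qed.

Lemma path_order_attained : exists2 s, size s = path_order e & sorted e s.
Proof.
have ne : 0 < #|[pred k : 'I_#|T|.+1 | [exists s : k.-tuple T, uniq s && sorted e s]]|.
  by apply/card_gt0P; exists ord0; rewrite inE; apply/existsP; exists [tuple].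
have [k] := eq_bigmax_cond (fun k : 'I__ => k : nat) ne.
rewrite inE => /existsP[s /andP[_ es]] eqk; exists s => //.
by rewrite size_tuple /path_order -eqk.
Qed.

Lemma path_order_le p : (forall x, lvl x < p) -> path_order e <= p.
Proof.
move=> lvlp; have [s <- /levelled_sorted es] := path_order_attained.
rewrite -(size_map lvl) -(size_iota 0 p); apply: uniq_leq_size.
  exact: sorted_uniq ltn_trans ltnn _ es.
by move=> _ /mapP[x _ ->]; rewrite mem_iota add0n leq0n; apply: lvlp.
Qed.

(** The new level of [x] is the largest number of vertices preceding it on a directed path, so there
    are no more levels than vertices on a longest path. *)
Lemma path_order_layering : exists f : T -> nat,
  (forall x y, e x y -> f x < f y) /\ forall x, f x < path_order e.
Proof.
pose P x := [pred k : 'I_#|T|.+1 | [exists s : k.-tuple T, sorted e (rcons s x)]].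
exists (fun x => \max_(k | P x k) k).
have att x : exists2 s, size s = \max_(k | P x k) k & sorted e (rcons s x).
  have ne : 0 < #|P x|.
    by apply/card_gt0P; exists ord0; rewrite inE; apply/existsP; exists [tuple].
  have [k] := eq_bigmax_cond (fun k : 'I__ => k : nat) ne.
  rewrite inE => /existsP[s es] eqk; exists s => //.
  by rewrite size_tuple -eqk.
split=> [x y exy|x]; last first.
  by have [s <- /leq_path_order] := att x; rewrite size_rcons.
have [s <- es] := att x.
have es2 : sorted e (rcons (rcons s x) y).
  case: s es => [|z s] /=; first by rewrite exy.
  by rewrite !rcons_path last_rcons exy andbT.
have lt : (size s).+1 < #|T|.+1.
  have : size (rcons (rcons s x) y) <= #|T|.
    by rewrite -(card_uniqP (levelled_uniq es2)); apply: max_card.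
  by rewrite !size_rcons => /ltnW.
apply: (@leq_bigmax_cond _ _ _ (Ordinal lt)).
have sz : size (rcons s x) == (size s).+1 by rewrite size_rcons.
by apply/existsP; exists (Tuple sz).
Qed.

Lemma linked_levelled x y : linked e x y -> lvl x < lvl y ->
  e x y \/ exists2 z, e x z & e z y.
Proof.
move=> lxy xy; case/or4P: lxy => [|/lvlE yx|/existsP[z /andP[]]|/existsP[z /andP[/lvlE yz /lvlE zx]]].
- by left.
- by have := ltn_trans xy yx; rewrite ltnn.
- by right; exists z.
by have := ltn_trans xy (ltn_trans yz zx); rewrite ltnn.
Qed.

Lemma linked_lvl_neq x y : linked e x y -> lvl x != lvl y.
Proof.
rewrite neq_ltn; case/or4P=> [/lvlE->|/lvlE->||]; rewrite ?orbT //.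
  by case/existsP=> z /andP[/lvlE xz /lvlE zy]; rewrite (ltn_trans xz zy).
by case/existsP=> z /andP[/lvlE yz /lvlE zx]; rewrite (ltn_trans yz zx) orbT.
Qed.

(** * Linked vertices in large girth *)

Section Girth.

Variable h : nat.
Hypothesis scf : short_cycle_free (underlying e) h.
Hypothesis h_ge6 : 6 <= h.

(** The chord would close a cycle on 3 to 6 vertices. *)
Lemma no_chord x s : path e x s -> 1 < size s < 6 -> ~~ e x (last x s).
Proof.
move=> pxs /andP[s1 s6]; apply/negP => exy.
have us : uniq (x :: s) by apply: levelled_uniq.
have szc : 2 < size (x :: s) <= h by rewrite /= ltnS s1 (leq_trans _ h_ge6).
apply: (negP (scf szc)); rewrite /ucycleb us andbT /= rcons_path.
rewrite {2}/underlying exy orbT andbT.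
by apply: sub_path pxs => a b; rewrite /underlying => ->.
Qed.

(** The detour through [w] would close a cycle on 4 to 6 vertices. *)
Lemma no_ear x s w : path e x s -> 1 < size s < 5 -> w \notin s ->
  e x w -> ~~ e w (last x s).
Proof.
move=> pxs /andP[s1 s5] ws xw; apply/negP => wy.
have us : uniq (x :: s) by apply: levelled_uniq.
have szc : 2 < size (w :: x :: s) <= h.
  by rewrite /= !ltnS (ltnW s1) (leq_trans _ h_ge6).
apply: (negP (scf szc)); rewrite /ucycleb cons_uniq us inE negb_or ws !andbT.
have -> : w != x by apply: contraTneq (lvlE xw) => ->; rewrite ltnn.
rewrite andbT /= rcons_path {1 3}/underlying xw wy !orbT andbT.
by apply: sub_path pxs => a b; rewrite /underlying => ->.
Qed.

(** The first two links concatenate to a directed path from [x] through [y] to [z] with two to four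
    arcs. An arc from [x] to [z] would be a chord of it. A path through some [w] other than [y]
    would be an ear, or, if [w] is on the path, would contain a chord of a subpath; so the third
    link passes through [y]. *)
Lemma linked_triple x y z : lvl x < lvl y -> lvl y < lvl z ->
  linked e x y -> linked e y z -> linked e x z -> e x y /\ e y z.
Proof.
move=> xy yz lxy lyz lxz.
have xz := ltn_trans xy yz.
have [s1 [p1 l1 z1 S1]] : exists s1, [/\ path e x (rcons s1 y), size s1 <= 1,
    z \notin s1 & forall w, w \in s1 -> path e w [:: y]].
  case: (linked_levelled lxy xy) => [exy|[a xa ay]]; first by exists [::]; rewrite /= exy.
  exists [:: a]; split=> //=; first by rewrite xa ay.
    rewrite inE; apply: contraTneq (lvlE ay) => <-; rewrite -leqNgt; exact: ltnW.
  by move=> w; rewrite inE => /eqP->; rewrite ay.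
have [s2 [p2 l2 S2]] : exists s2, [/\ path e y (rcons s2 z), size s2 <= 1 &
    forall w, w \in s2 -> path e y [:: w]].
  case: (linked_levelled lyz yz) => [eyz|[b yb bz]]; first by exists [::]; rewrite /= eyz.
  exists [:: b]; split=> //=; first by rewrite yb bz.
  by move=> w; rewrite inE => /eqP->; rewrite yb.
pose s := rcons s1 y ++ rcons s2 z.
have ps : path e x s by rewrite cat_path p1 last_rcons.
have ls : last x s = z by rewrite last_cat last_rcons.
have szs : 1 < size s < 5.
  by rewrite size_cat !size_rcons addSn addnS !ltnS leq0n /=; apply: (leq_add l1 l2).
case: (linked_levelled lxz xz) => [exz|[w xw wz]].
  have szs' : 1 < size s < 6 by case/andP: szs => -> /ltnW.
  by have := no_chord ps szs'; rewrite ls exz.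
have [ws|ws] := boolP (w \in s); last first.
  by have := no_ear ps szs ws xw; rewrite ls wz.
have wz' : w != z by apply: contraTneq (lvlE wz) => ->; rewrite ltnn.
move: ws; rewrite mem_cat !mem_rcons !inE (negPf wz') /=.
have [wy _|wy /= ws] := eqVneq w y; first by rewrite -wy.
case/orP: ws => [w1|w2].
  have pw : path e w (y :: rcons s2 z) by have /= /andP[-> _] := S1 w w1.
  have szp : 1 < size (y :: rcons s2 z) < 6.
    by rewrite /= size_rcons !ltnS (leq_trans l2).
  by have := no_chord pw szp; rewrite /= last_rcons wz.
have pw : path e x (rcons (rcons s1 y) w).
  by rewrite rcons_path p1 last_rcons; have /= /andP[-> _] := S2 w w2.
have szp : 1 < size (rcons (rcons s1 y) w) < 6.
  by rewrite !size_rcons !ltnS leq0n (leq_trans l1).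
by have := no_chord pw szp; rewrite last_rcons xw.
Qed.

(** For four pairwise linked vertices sorted by level, [linked_triple] yields the arcs from [x2] to
    [x3], from [x3] to [x4] and from [x2] to [x4], a forbidden triangle. *)
Lemma omega_ro_le3 : omega_ro e <= 3.
Proof.
apply/bigmax_leqP => A /forall_inP lA; rewrite leqNgt; apply/negP => A4.
have link x y : x \in A -> y \in A -> x != y -> linked e x y.
  by move=> xA yA; apply/implyP; move/forall_inP: (lA x xA); apply.
pose s := sort (relpre lvl leq) (enum A).
have ps : pairwise (fun x y => lvl x < lvl y) s.
  have tr : transitive (relpre lvl leq) by move=> a b c; apply: leq_trans.
  have : sorted (relpre lvl leq) s by apply: sort_sorted => a b; apply: leq_total.
  have : uniq s by rewrite sort_uniq enum_uniq.
  have : {subset s <= A} by move=> a; rewrite mem_sort mem_enum.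
  rewrite sorted_pairwise //; elim: (s) => //= a r IH sA /andP[ar ur] /andP[lea pr].
  rewrite IH ?andbT //; last by move=> b br; apply: sA; rewrite inE br orbT.
  apply/allP => b br; rewrite ltn_neqAle; apply/andP; split; last exact: (allP lea b br).
  apply: linked_lvl_neq; apply: link; rewrite ?sA ?inE ?eqxx ?br ?orbT //.
  by apply: contraNneq ar => ->.
have : size s = #|A| by rewrite size_sort cardE.
have sA : {subset s <= A} by move=> a; rewrite mem_sort mem_enum.
case: s ps sA => [|x1 [|x2 [|x3 [|x4 s]]]] ps sA sz; rewrite -sz // in A4.
move: ps => /= /andP[/and4P[l12 l13 l14 _] /andP[/and3P[l23 l24 _] /andP[/andP[l34 _] _]]].
have lk a b : a \in [:: x1, x2, x3, x4 & s] -> b \in [:: x1, x2, x3, x4 & s] ->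
    lvl a < lvl b -> linked e a b.
  move=> /sA aA /sA bA ab; apply: link => //.
  by apply: contraTneq ab => ->; rewrite ltnn.
have [_ e23] : e x1 x2 /\ e x2 x3 by apply: linked_triple => //; apply: lk; rewrite ?inE ?eqxx ?orbT.
have [_ e34] : e x2 x3 /\ e x3 x4 by apply: linked_triple => //; apply: lk; rewrite ?inE ?eqxx ?orbT.
have [_ e24] : e x1 x2 /\ e x2 x4 by apply: linked_triple => //; apply: lk; rewrite ?inE ?eqxx ?orbT.
have := @no_chord x2 [:: x3; x4]; rewrite /= e23 e34 e24 => /(_ isT isT) //.
Qed.

End Girth.

Lemma omega_ao_le_ro : omega_ao e <= omega_ro e.
Proof.
apply/bigmax_leqP => -[A B] /= /andP[/forall_inP sub /forall_inP lA].
apply: (@leq_bigmax_cond _ (pairwise_linked e) (fun A : {set T} => #|A|)).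
have eB x y : (x, y) \in B -> e x y by move/sub => /and3P[].
apply/forall_inP => x xA; apply/forall_inP => y yA; apply/implyP => xy.
have /implyP/(_ xy) := forall_inP (lA x xA) y yA.
rewrite /linked /= => /or4P[/eB->|/eB->||]; rewrite ?orbT //.
  by case/existsP=> z /andP[/eB xz /eB zy]; apply/or4P/Or43/existsP; exists z; rewrite xz.
by case/existsP=> z /andP[/eB xz /eB zy]; apply/or4P/Or44/existsP; exists z; rewrite xz.
Qed.

(** A directed path on three vertices is an oriented clique, its ends being linked through the
    middle. *)
Lemma omega_ao_ge3 : 3 <= path_order e -> 3 <= omega_ao e.
Proof.
have [s <- es] := path_order_attained; case: s es => [|x [|y [|z s]]] //= /and3P[xy yz _] _.
pose K := ([set x; y; z], [set (x, y); (y, z)]).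
have us : uniq [:: x; y; z] by apply: levelled_uniq; rewrite /= xy yz.
have <- : #|K.1| = 3.
  move: us; rewrite /= !inE negb_or !andbT => /andP[/andP[n12 n13] n23].
  by rewrite /K /= -setUA cardsU1 cards2 !inE negb_or n12 n13 n23.
apply: (@leq_bigmax_cond _ _ (fun K : {set T} * {set T * T} => #|K.1|)).
apply/andP; split.
  by apply/forall_inP => a; rewrite /K /= !inE => /orP[] /eqP->; rewrite /= ?xy ?yz !eqxx ?orbT.
have Kxy : (x, y) \in K.2 by rewrite !inE eqxx.
have Kyz : (y, z) \in K.2 by rewrite !inE eqxx orbT.
have Kxyz : [exists w, ((x, w) \in K.2) && ((w, z) \in K.2)].
  by apply/existsP; exists y; rewrite Kxy.
apply/forall_inP => a; rewrite !inE -orbA => /or3P[] /eqP->; apply/forall_inP => b;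
  rewrite !inE -orbA => /or3P[] /eqP->; rewrite ?eqxx //; apply/implyP => _;
  rewrite /linked ?Kxy ?Kyz ?Kxyz ?orbT //.
Qed.

End LevelledGraph.

(** * Transfer to components and membership in the family *)

Lemma girth_gt_short_cycle_free (T : finType) (a : rel T) g h :
  g <= h -> short_cycle_free a h -> girth_gt a g.
Proof.
move=> gh scf; rewrite /girth_gt /girth.
case E: (ohead _) => [k|] //.
have : k \in [seq k <- iota 0 #|T|.+1 | has_cycle a k].
  by case: (filter _ _) E => //= k' s [->]; rewrite inE eqxx.
rewrite mem_filter => /andP[/andP[k2 /existsP[c cyc]] _].
rewrite ltnNge; apply/negP => kg.
have szc : 2 < size c <= h by rewrite size_tuple k2 (leq_trans kg).
by rewrite (negPf (scf c szc)) in cyc.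
Qed.

Lemma short_cycle_free_sub (T T' : finType) (f : T' -> T) (e : rel T) h :
  injective f -> short_cycle_free (underlying e) h ->
  short_cycle_free (underlying (relpre f e)) h.
Proof.
move=> inj scf c szc; have := scf (map f c); rewrite size_map => /(_ szc).
by rewrite /ucycleb cycle_map map_inj_uniq.
Qed.

Lemma leq_max_outdeg (T T' : finType) (f : T' -> T) (e : rel T) d :
  injective f -> (forall u, #|[set v | e u v]| <= d) -> max_outdeg (relpre f e) <= d.
Proof.
move=> inj le; apply/bigmax_leqP => u _; rewrite -(card_imset _ inj).
apply: leq_trans (le (f u)); apply/subset_leq_card/subsetP => _ /imsetP[v + ->].
by rewrite !inE.
Qed.

Lemma leq_max_indeg (T T' : finType) (f : T' -> T) (e : rel T) d :
  injective f -> (forall v, #|[set u | e u v]| <= d) -> max_indeg (relpre f e) <= d.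
Proof.
move=> inj le; apply/bigmax_leqP => u _; rewrite -(card_imset _ inj).
apply: leq_trans (le (f u)); apply/subset_leq_card/subsetP => _ /imsetP[v + ->].
by rewrite !inE.
Qed.

Lemma trans_ramsey_exists p : 0 < p -> exists n, is_trans_ramsey p n.
Proof.
case: p => // p _; pose P n := forall (V : finType) (t : rel V), #|V| = n ->
  tournament t -> exists f : 'I_p.+1 -> V,
    injective f /\ homomorphism (@trans_tournament p.+1) t f.
suff /well_order_nat[n ln _] : P (2 ^ p) by exists n.
move=> V t cV tt; have [|s [<- _ ps]] := @trans_ramsey_pow2 V t p setT tt.
  by rewrite cardsT cV.
exact: pairwise_trans_tournament.
Qed.

Lemma trans_ramsey_extremal p n : 0 < p -> is_trans_ramsey p n ->
  exists (D : finType) (t : rel D), [/\ #|D|.+1 = n, tournament t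
    & forall s, size s = p -> ~~ pairwise t s].
Proof.
move=> p0 [ram least].
have [D] : exists D : finType, exists t : rel D, [/\ #|D| = n.-1, tournament t
    & ~ exists f : 'I_p -> D, injective f /\ homomorphism (@trans_tournament p) t f].
  apply: NNPP => none.
  have : n <= n.-1.
    apply: least => V t cV tt; apply: NNPP => nof; apply: none.
    by exists V, t.
  (* For [n = 0], where [n.-1 = n], the empty tournament would have to contain a vertex, since
     [0 < p]. *)
  case: n ram {least none} => [|n] ram; last by rewrite ltnn.
  move=> _.
  have tt0 : tournament (fun _ _ : void => false) by split=> [[]|[]].
  by have [f _] := ram void _ card_void tt0; case: (f (Ordinal p0)).
case=> t [cD tt nof]; exists D, t; split=> //.
  rewrite cD prednK //; case: n ram cD {least} => // ram cD; case: nof.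
  exact: ram.
move=> s sp; apply/negP => /(pairwise_trans_tournament tt); rewrite sp; exact: nof.
Qed.

(** The levels map [e] into a transitive tournament of order [p], which every tournament on
    [#|D|.+1] vertices contains. An order [k <= #|D|] is ruled out by restricting [t] to [k]
    vertices. *)
Lemma compressibility_eq_trans_ramsey (T D : finType) (e : rel T) (lvl : T -> nat)
    (t : rel D) p :
  (forall x y, e x y -> lvl x < lvl y) -> (forall x, lvl x < p) -> 0 < p ->
  tournament t -> (forall f, ~ homomorphism e t f) ->
  is_trans_ramsey p #|D|.+1 -> is_compressibility e #|D|.+1.
Proof.
move=> lvlE lvlp p0 tt nohom [ram _]; split.
  split=> // V t' cV tt'; have [f [_ hf]] := ram V t' cV tt'.
  exists (fun x => f (Ordinal (lvlp x))) => x y exy.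
  by apply: hf; apply: lvlE.
move=> k [_ kV]; rewrite ltnNge; apply/negP; rewrite -cardsT.
case/card_set_of_size => S _ cS.
have [||f hf] := kV {x | x \in S} (relpre val t).
- by rewrite card_sig cS.
- by split=> [x|x y xy] /=; [apply: tt.1 | apply: tt.2].
by apply: (nohom (val \o f)) => x y /hf.
Qed.

(** If longest paths had fewer than [p] vertices, the layering by [path_order_layering] would map
    [e] into a transitive subtournament of [D] of order [p.-1], against [nohom]. *)
Lemma levelled_calH (T D : finType) (e : rel T) (lvl : T -> nat) (t : rel D) g h p :
  (forall x y, e x y -> lvl x < lvl y) -> (forall x, lvl x < p) -> 3 <= p ->
  Defs.connected e -> g <= h -> 6 <= h -> short_cycle_free (underlying e) h ->
  tournament t -> (forall f, ~ homomorphism e t f) ->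
  is_trans_ramsey p #|D|.+1 -> calH g p e.
Proof.
move=> lvlE lvlp p3 conn gh h6 scf tt nohom ram.
have p0 : 0 < p by apply: leq_trans p3.
have poE : path_order e = p.
  apply/eqP; rewrite eqn_leq (path_order_le lvlE) //= leqNgt; apply/negP => lt.
  have [s sz ps] := trans_pred_of_ramsey p0 tt ram.1.
  have [f [fE flt]] := path_order_layering lvlE.
  have f_lt x : f x < size s.
    by rewrite sz; apply: leq_trans (flt x) _; rewrite -ltnS prednK.
  apply: (nohom (fun x => tnth (in_tuple s) (Ordinal (f_lt x)))) => x y exy.
  have d0 := tnth (in_tuple s) (Ordinal (f_lt x)).
  rewrite !(tnth_nth d0) /=; move/(pairwiseP d0): ps.
  by apply; rewrite ?inE ?f_lt ?fE.
have ro3 := omega_ro_le3 lvlE scf h6.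
have ao3 : 3 <= omega_ao e by apply: (omega_ao_ge3 lvlE); rewrite poE.
have aoro := omega_ao_le_ro e.
split=> //.
- exact: levelled_oriented lvlE.
- exact: levelled_acyclic lvlE.
- exact: girth_gt_short_cycle_free gh scf.
- by apply/eqP; rewrite eqn_leq ao3 (leq_trans aoro).
- by apply/eqP; rewrite eqn_leq ro3 (leq_trans ao3).
by exists #|D|.+1; split=> //; apply: compressibility_eq_trans_ramsey lvlE lvlp p0 tt nohom ram.
Qed.

Lemma sparse_calH_exists g p h : 3 <= p -> g <= h -> 6 <= h ->
  exists (T : finType) (e : rel T), [/\ calH g p e,
    #|T| <= 96 * 192 ^ h * p ^ (2 * h + 3),
    max_outdeg e <= 96 * p * p.-1 & max_indeg e <= 96 * p * p.-1].
Proof.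
move=> p3 gh h6; have p0 : 0 < p by apply: leq_trans p3.
have p1 : 1 < p by apply: leq_trans p3.
have [n ram] := trans_ramsey_exists p0.
have [D [t [cD tt nt]]] := trans_ramsey_extremal p0 ram; rewrite -{n}cD in ram.
have Dlt : #|D| < 2 ^ p.
  rewrite ltnNge; apply/negP => le.
  have [|s [sz _ ps]] := @trans_ramsey_pow2 D t p.-1 setT tt.
    by rewrite cardsT (leq_trans _ le) // leq_exp2l // leq_pred.
  by have := nt s; rewrite ps sz prednK // => /(_ erefl).
have [s0 sz0 _] := trans_pred_of_ramsey p0 tt ram.1.
have d0 : D by case: s0 sz0 => [|d _ _ //]; case: (p) p1 => [|[]].
(* [192 * p ^ 2] is a round upper bound for [(96 * p * p.-1).*2.+1], which makes [L] large enough;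
   [p] classes of [2 * L] vertices then give the bound on [#|T|]. *)
pose L := 48 * p ^ 2 * (192 * p ^ 2) ^ h.
have pL : p <= L.
  rewrite /L; apply: (@leq_trans (48 * p ^ 2)).
    by rewrite expnS expn1 mulnA -{1}[p]mul1n leq_mul2r muln_gt0 p0 orbT.
  by rewrite leq_pmulr // expn_gt0 muln_gt0 expn_gt0 p0.
have Dp : (96 * p * p.-1).*2.+1 <= 192 * p ^ 2.
  by case: (p) p0 => // q _; rewrite -mul2n -mulnn /=; clear; nia.
have LL : 48 * p ^ 2 * (96 * p * p.-1).*2.+1 ^ h <= L.
  by rewrite leq_mul2l leq_exp2r ?Dp ?orbT // (leq_trans _ h6).
have [e [lvlE od id scf nohom]] := sparse_graph_exists d0 tt nt p1 Dlt pL LL.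
have [x0 nohom0] := component_not_homomorphic nohom.
pose T0 := {y | connect (underlying e) x0 y}.
pose e0 : rel T0 := relpre val e; pose lvl (x : T0) : nat := (val x).1.
exists T0, e0; split.
- have lvlE0 x y : e0 x y -> lvl x < lvl y by apply: lvlE.
  have scf0 : short_cycle_free (underlying e0) h by apply: short_cycle_free_sub val_inj scf.
  apply: (levelled_calH lvlE0 _ p3 _ gh h6 scf0 tt nohom0 ram).
    by move=> x; apply: ltn_ord.
  exact: component_connected.
- rewrite card_sig (leq_trans (max_card _)) // card_prod !card_ord /L.
  rewrite leq_eqVlt; apply/orP; left; apply/eqP.
  rewrite expnMn -expnM -mul2n expnD; clear; ring.
- exact: leq_max_outdeg val_inj od.
exact: leq_max_indeg val_inj id.
Qed.

Theorem theorem4p1 :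
  exists C : nat -> nat, forall g p : nat, 1 <= g -> 3 <= p ->
    let h := maxn g 12 in
    exists m d : nat,
      [/\ is_m g p m, is_d g p d,
          m <= C h * p ^ (3 * h - 1),
          d <= 96 * p * (p - 1)
        & 96 * p * (p - 1) < 96 * p ^ 2].
Proof.
exists (fun h => 96 * 192 ^ h) => g p _ p3 h.
have gh : g <= h by apply: leq_maxl.
have h12 : 12 <= h by apply: leq_maxr.
have [T [e [He cT od id]]] := sparse_calH_exists p3 gh (leq_trans (isT : 6 <= 12) h12).
have p0 : 0 < p by apply: leq_trans p3.
have [m mP mT] := well_order_nat (ex_intro _ T (ex_intro _ e (conj He erefl)) :
  (fun n => exists (T : finType) (e : rel T), calH g p e /\ #|T| = n) #|T|).
have [d dP dT] := well_order_nat (ex_intro _ T (ex_intro _ e (conj He erefl)) :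
  (fun n => exists (T : finType) (e : rel T),
     calH g p e /\ maxn (max_outdeg e) (max_indeg e) = n)
  (maxn (max_outdeg e) (max_indeg e))).
exists m, d; split=> //.
(* The exponents compare because [2 * h + 3 <= 3 * h - 1], by [12 <= h]. *)
- apply: leq_trans mT (leq_trans cT _); rewrite leq_mul2l; apply/orP; right.
  by rewrite leq_pexp2l //; lia.
- by rewrite subn1 (leq_trans dT) // geq_max od.
by rewrite subn1 -mulnA ltn_pmul2l // -mulnn ltn_pmul2l // prednK.
Qed.
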